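(* (1) For any $d\geq 3$ there are non-periodic non face-to-face tilings of $\mathbb{R}^d$ by convex polytopes that are monocoronal up to congruence. (2) For any $d\geq 4$ there are non-periodic non face-to-face tilings of $\mathbb{R}^d$ by convex polytopes that are monocoronal up to rigid motions.
   Context: A tiling of $\mathbb{R}^d$ is a countable collection $\{T_1,T_2,\ldots\}$ of compact sets (the tiles), here convex polytopes, such that $\bigcup_i T_i=\mathbb{R}^d$ and the interiors of $T_i$ and $T_j$ are disjoint for $i\neq j$. It is face-to-face if the intersection of any two tiles is an entire face (possibly of dimension less than $d$, possibly empty) of both tiles, and non face-to-face otherwise. A vertex of a tiling is a point that is a vertex of at least one tile. The vertex corona of a vertex $x$ is the set of all tiles $T$ of the tiling with $x\in T$, together with the point $x$. Two subsets $A,B\subset\mathbb{R}^d$ are congruent if $A=t+RB$ for some $t\in\mathbb{R}^d$ and $R\in O(d)$, and directly congruent if $A=t+RB$ for some $t\in\mathbb{R}^d$ and $R\in SO(d)$. Vertex coronae of $x$ and $y$ are (directly) congruent if such an isometry maps $x$ to $y$ and the tiles of one corona onto the tiles of the other. A tiling is monocoronal up to congruence (resp. up to rigid motions) if all its vertex coronae are congruent (resp. directly congruent). The symmetry group of a tiling is the group of all isometries of $\mathbb{R}^d$ mapping the tiling to itself. A tiling is non-periodic if its symmetry group contains no nontrivial translation. *)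

(* Defs.v *)
From HB Require Import structures.
From mathcomp Require Import all_boot all_order all_algebra.
From mathcomp Require Import all_classical all_reals all_analysis.

Set Implicit Arguments.
Unset Strict Implicit.
Unset Printing Implicit Defensive.
Import Order.TTheory GRing.Theory Num.Theory.
Import numFieldNormedType.Exports.

Local Open Scope classical_set_scope.
Local Open Scope ring_scope.

(* Points of R^d are row vectors ['rV[R]_d]; the library topology on them is
   the product topology.  The library norm on matrices is the sup norm, so the
   Euclidean structure is introduced explicitly. *)

Section Euclidean.
Variables (R : realType) (d : nat).
Local Notation E := 'rV[R]_d.

Definition dotp (u v : E) : R := \sum_(i < d) u ord0 i * v ord0 i.

Definition enorm (u : E) : R := Num.sqrt (dotp u u).

Definition isometry (f : E -> E) : Prop :=
  forall x y, enorm (f x - f y) = enorm (x - y).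

Definition orthogonal_group : set 'M[R]_d := [set Q | Q *m Q^T = 1%:M].

Definition special_orthogonal_group : set 'M[R]_d :=
  [set Q | orthogonal_group Q /\ \det Q = 1].

(* Linear maps act on row vectors by multiplication on the right. *)
Definition affine_map (Q : 'M[R]_d) (t : E) (x : E) : E := t + x *m Q.

End Euclidean.

Section Polytopes.
Variables (R : realType) (d : nat).
Local Notation E := 'rV[R]_d.

Definition convex_hull (A : set E) : set E := smallest (@convex_set R E) A.

Definition convex_polytope (P : set E) : Prop :=
  exists2 V : set E, finite_set V & P = convex_hull V.

(* The choices c = 0, b = 0 and c = 0, b = 1 make [P] itself and the empty set
   faces of [P]. *)
Definition face (F P : set E) : Prop :=
  exists c b, (forall x, P x -> dotp c x <= b) /\
              F = P `&` [set x | dotp c x = b].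

Definition polytope_vertex (P : set E) (x : E) : Prop := face [set x] P.

End Polytopes.

Section Tilings.
Variables (R : realType) (d : nat).
Local Notation E := 'rV[R]_d.
Implicit Type tau : set (set E).

Definition tiling tau : Prop :=
  [/\ countable tau,
      forall T, tau T -> compact T,
      \bigcup_(T in tau) T = setT &
      forall T1 T2, tau T1 -> tau T2 -> T1 <> T2 ->
        interior T1 `&` interior T2 = set0].

(* Tiles are full-dimensional: without the condition on interiors, arbitrary
   polytopes of lower dimension could be added to a tiling. *)
Definition tiling_by_convex_polytopes tau : Prop :=
  tiling tau /\
  forall T, tau T -> convex_polytope T /\ interior T !=set0.

Definition face_to_face tau : Prop :=
  forall T1 T2, tau T1 -> tau T2 ->
    face (T1 `&` T2) T1 /\ face (T1 `&` T2) T2.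

Definition tiling_vertex tau (x : E) : Prop :=
  exists2 T, tau T & polytope_vertex T x.

Definition vertex_corona tau (x : E) : E * set (set E) :=
  (x, [set T | tau T /\ T x]).

Definition image_tiles (f : E -> E) tau : set (set E) :=
  [set f @` T | T in tau].

Definition coronae_congruent (G : set 'M[R]_d) (C1 C2 : E * set (set E)) :
    Prop :=
  exists Q t, [/\ G Q, affine_map Q t C1.1 = C2.1 &
                  image_tiles (affine_map Q t) C1.2 = C2.2].

Definition monocoronal (G : set 'M[R]_d) tau : Prop :=
  forall x y, tiling_vertex tau x -> tiling_vertex tau y ->
    coronae_congruent G (vertex_corona tau x) (vertex_corona tau y).

Definition monocoronal_up_to_congruence tau : Prop :=
  monocoronal (@orthogonal_group R d) tau.

Definition monocoronal_up_to_rigid_motions tau : Prop :=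
  monocoronal (@special_orthogonal_group R d) tau.

Definition symmetry_group tau : set (E -> E) :=
  [set f | isometry f /\ image_tiles f tau = tau].

Definition non_periodic tau : Prop :=
  forall t : E, symmetry_group tau (fun x => x + t) -> t = 0.

End Tilings.

(* Main.v *)
Require Import Defs.
From mathcomp Require Import all_boot all_order all_algebra.
From mathcomp Require Import all_classical all_reals all_analysis.
From mathcomp Require Import perm ring lra zify.

Set Implicit Arguments.
Unset Strict Implicit.
Unset Printing Implicit Defensive.
Import Order.TTheory GRing.Theory Num.Theory.
Import numFieldNormedType.Exports.
Local Open Scope classical_set_scope.
Local Open Scope ring_scope.

(** Write d = n + 1 with n >= 2, and let e_1, ..., e_n be vectors of R^n with
    Gram matrix 1 + J/3, where J is the all-ones matrix.  They span a lattice
    whose fundamental parallelepiped P tiles R^n face-to-face; stacking one unit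
    of height on it gives a layer of parallelepipeds in R^d.  The tiling is a
    stack of such layers, indexed by the integers, in which every layer is the
    mirror image of its neighbour in a vertical hyperplane orthogonal to some
    e_i, at distance 1/8 of an edge from a vertex.

    Coronae.  Let g_i be the reflection along e_i.  It sends e_j to
    e_j - e_i/2 for j <> i, so the lattice M and its image g_i M meet in a
    subgroup of index 2.  The translations by this subgroup preserve the pair of
    layers; so does a central symmetry of R^n, which exchanges the two classes
    of M modulo the subgroup; and the mirror image, turned upside down,
    exchanges the two layers.  So all vertices between two consecutive layers
    look alike.  A permutation of the e_j shows that the choice of i does not
    matter, so all vertex coronae are congruent ([corona_standard]).  If n >= 3,
    the exchange of two of the e_j with j <> i is an orientation reversing
    symmetry of the corona ([standard_corona_swap]), hence the coronae are even
    directly congruent.  The vertices of a layer lie on edges of the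
    neighbouring layer, at a quarter of their length, so the tiling is not
    face-to-face ([stack_not_face_to_face]).

    Translations.  A translation that preserves height belongs to the lattices
    of all layers, that is, its coordinate vector stays integral when the
    reflections g_i are applied to it one after another.  They are ordered in
    longer and longer blocks in which two of them alternate ([refl_order]).  Let
    c_k e_i be the vector subtracted by the k-th reflection.  Inside a block the
    c_k are integers of bounded size with 2 c_(k+2) + c_(k+1) + 2 c_k = 0, and
    this forces high powers of 2 to divide those in the middle of the block; they
    vanish if the block is long ([dyadic_vanish]).  So from some point on the
    vector is fixed by all reflections, and it is zero ([translation_trivial]).
    A translation that changes the height by q units, with q nonzero, carries
    every lattice into the one that comes |q| steps later in the sequence.  As
    finitely many of the lattices always have a common nonzero vector, so would
    all of them, which is absurd ([common_translation], [stack_non_periodic]).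

    The proof works in coordinates with respect to (e_0, e_1, ..., e_n), where
    e_0 is the vertical unit vector, has index [ord0], and is orthogonal to the
    others.  The Euclidean structure becomes the bilinear form [bform], the
    tiles of the untransformed layers are the integer cubes [cube m], and
    symmetries of the lattice become signed permutations of the coordinates. *)

(** * Affine images of integer cubes *)

Lemma row_ext (T : Type) d (u v : 'rV[T]_d) :
  (forall i, u ord0 i = v ord0 i) -> u = v.
Proof. by move=> uv; apply/rowP => i; exact: uv. Qed.

Section AffineCubes.
Variables (R : realType) (d : nat).
Local Notation E := 'rV[R]_d.

Lemma convex_setP (K : set E) :
  @convex_set R E K <->
  forall x y l, K x -> K y -> 0 <= l -> l <= 1 -> K (l *: x + (1 - l) *: y).
Proof.
split=> [cK x y l Kx Ky l0 l1|cK x y l].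
  by have /set_mem := cK x y (Itv01 l0 l1) (mem_set Kx) (mem_set Ky).
by rewrite !inE => Kx Ky; apply: cK.
Qed.

(** An integer vector, read as a point of Euclidean space. *)
Definition ivec (m : 'rV[int]_d) : E := map_mx intr m.

Lemma ivecE m i : ivec m ord0 i = (m ord0 i)%:~R.
Proof. by rewrite mxE. Qed.

(** The unit cube with least vertex [m]. *)
Definition cube (m : 'rV[int]_d) : set E :=
  [set s | forall i, (m ord0 i)%:~R <= s ord0 i <= (m ord0 i)%:~R + 1].

Lemma ivec_cube m : cube m (ivec m).
Proof. by move=> i; rewrite ivecE lexx lerDl ler01. Qed.

Lemma cube_compact m : compact (cube m).
Proof.
rewrite (_ : cube m = [set v : E | forall i,
  `[(m ord0 i)%:~R, (m ord0 i)%:~R + 1]%classic (v ord0 i)]).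
  apply: (@rV_compact R d (fun i =>
    `[(m ord0 i)%:~R, (m ord0 i)%:~R + 1]%classic)).
  by move=> i; exact: segment_compact.
by apply/seteqP; split=> v /= vm i; have := vm i; rewrite in_itv.
Qed.

Variables (A : 'M[R]_d) (t : E).
Hypothesis Au : A \in unitmx.
Local Notation D := (affine_map A t).
Local Notation D' := (affine_map (invmx A) (- t *m invmx A)).

Lemma affine_mapK : cancel D D'.
Proof.
by move=> x; rewrite /affine_map mulmxDl mulmxK// mulNmx addrA addNr add0r.
Qed.

Lemma affine_mapVK : cancel D' D.
Proof.
by move=> x; rewrite /affine_map mulmxDl !mulmxKV// addrA subrr add0r.
Qed.

Lemma affine_map_continuous (M : 'M[R]_d) (u : E) :
  continuous (affine_map M u).
Proof.
rewrite (_ : affine_map M u = fun y : E =>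
  u + \sum_i (y ord0 i *: row i M)); last first.
  by apply/funext=> y; rewrite /affine_map mulmx_sum_row.
have coordZ i : continuous (fun y : E => y ord0 i *: row i M).
  by move=> x; apply: (@cvgZr_tmp R E E (nbhs x)); exact: coord_continuous.
move=> x; apply: (@cvgD R E E (nbhs x) _ (fun=> u)); first exact: cvg_cst.
apply: (@cvg_big E _ _ _ _ _ E (nbhs x)).
  exact: (@pseudometric_normed_Zmodule.add_continuous R E).
by move=> i _; exact: coordZ.
Qed.

Lemma affine_imageE (K : set E) : D @` K = D' @^-1` K.
Proof.
apply/seteqP; split=> [_ [x Kx <-]|x Kx]; first by rewrite /= affine_mapK.
by exists (D' x) => //; rewrite affine_mapVK.
Qed.

Lemma affine_cube_compact m : compact (D @` cube m).
Proof.
apply: continuous_compact; last exact: cube_compact.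
exact/continuous_subspaceT/affine_map_continuous.
Qed.

Lemma affine_cube_interior_neq0 m : interior (D @` cube m) !=set0.
Proof.
pose c : E := \row_i ((m ord0 i)%:~R + 2^-1).
exists (D c); rewrite affine_imageE.
apply: affine_map_continuous; rewrite affine_mapK.
apply/nbhs_ballP; exists 2^-1 => /=; first by rewrite invr_gt0.
move=> s [_ sc] i; have := sc ord0 i; rewrite mxE /ball /= ltr_distl => /andP[? ?].
by apply/andP; split; lra.
Qed.

Lemma affine_cube_interior m x : interior (D @` cube m) x ->
  exists2 u, x = D u &
    forall i, (m ord0 i)%:~R < u ord0 i < (m ord0 i)%:~R + 1.
Proof.
move=> xT; exists (D' x) => [|i]; first by rewrite affine_mapVK.
have : nbhs (D' x) (cube m).
  have : nbhs (D' x) (D @^-1` (D @` cube m)).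
    by apply: affine_map_continuous; rewrite affine_mapVK.
  by apply: filterS => y [z zm /(can_inj affine_mapK) <-].
move: (D' x) => v /nbhs_ballP[e /= e0 sub].
have h r : `|r| < e -> (m ord0 i)%:~R <= v ord0 i + r <= (m ord0 i)%:~R + 1.
  move=> re; have -> : v ord0 i + r = (v + r *: delta_mx ord0 i) ord0 i.
    by rewrite !mxE !eqxx mulr1.
  apply: sub; split=> // a j; rewrite /ball /= (ord1 a) !mxE.
  rewrite opprD addNKr normrN eqxx /= normrM.
  apply: le_lt_trans re; rewrite ler_piMr//.
  by case: (j == i); rewrite /= ?normr1 ?normr0.
have e2 : `|e / 2| < e by rewrite gtr0_norm; lra.
have e2N : `|- (e / 2)| < e by rewrite normrN.
have /andP[h1 _] := h _ e2N; have /andP[_ h2] := h _ e2.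
by apply/andP; split; lra.
Qed.

End AffineCubes.

Arguments ivec R {d} m.
Arguments cube R {d} m.

Lemma eqD1F (R : nzRingType) (x : R) : (x + 1 == x) = false.
Proof. by rewrite -subr_eq0 addrC addKr oner_eq0. Qed.

(** * Affine images of cubes as polytopes *)

Section AffineCubePolytopes.
Variables (R : realType) (d : nat).
Local Notation E := 'rV[R]_d.

Lemma affine_map_conv (A : 'M[R]_d) t (x y : E) (l : R) :
  affine_map A t (l *: x + (1 - l) *: y) =
  l *: affine_map A t x + (1 - l) *: affine_map A t y.
Proof.
rewrite /affine_map mulmxDl -!scalemxAl !scalerDr addrACA -scalerDl.
by rewrite (addrCA l) subrr addr0 scale1r.
Qed.

(** The vertices of [cube m], indexed by Boolean vectors. *)
Definition corner (m : 'rV[int]_d) (b : {ffun 'I_d -> bool}) : 'rV[int]_d :=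
  \row_i (m ord0 i + (b i)%:Z).

Lemma cornerE m b i :
  ivec R (corner m b) ord0 i = (m ord0 i)%:~R + (b i)%:R.
Proof. by rewrite ivecE mxE intrD. Qed.

Lemma corner_cube m b : cube R m (ivec R (corner m b)).
Proof.
by move=> i; rewrite cornerE; case: (b i) => /=; rewrite ?mulr0n ?mulr1n;
  apply/andP; split; lra.
Qed.

Lemma cornerP (m : 'rV[int]_d) (u : E) :
  (forall i, u ord0 i = (m ord0 i)%:~R \/ u ord0 i = (m ord0 i)%:~R + 1) ->
  exists b, u = ivec R (corner m b).
Proof.
move=> um; exists [ffun i => u ord0 i != (m ord0 i)%:~R].
apply/rowP => i; rewrite cornerE ffunE; case: (um i) => ->.
  by rewrite eqxx addr0.
by rewrite eqD1F.
Qed.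

(** The vector [u] with coordinate [j] changed to [r]. *)
Definition set_coord (u : E) (j : 'I_d) (r : R) : E :=
  \row_i (if i == j then r else u ord0 i).

Lemma set_coord_conv (u : E) j (a : R) :
  u = (u ord0 j - a) *: set_coord u j (a + 1) +
      (1 - (u ord0 j - a)) *: set_coord u j a.
Proof.
by apply/rowP => i; rewrite !mxE; case: eqP => [->|_]; ring.
Qed.

Lemma set_coord_cube m (u : E) j r : cube R m u ->
  (m ord0 j)%:~R <= r <= (m ord0 j)%:~R + 1 -> cube R m (set_coord u j r).
Proof. by move=> um rm i; rewrite mxE; case: eqP => [->|]. Qed.

Variables (A : 'M[R]_d) (t : E).
Local Notation D := (affine_map A t).

Lemma affine_cube_sub_convex m (K : set E) : @convex_set R E K ->
  (forall b, K (D (ivec R (corner m b)))) -> D @` cube R m `<=` K.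
Proof.
move=> /convex_setP Kconv Kb _ [u um <-].
(* induction on the number of coordinates that need not be extremal *)
suff H k : forall u, cube R m u -> (forall i : 'I_d, (k <= i)%N ->
    u ord0 i = (m ord0 i)%:~R \/ u ord0 i = (m ord0 i)%:~R + 1) -> K (D u).
  by apply: (H d) => // i; rewrite leqNgt ltn_ord.
elim: k => [|k IHk] {um}u um uk.
  by have [i|b ->] := @cornerP m u; [exact: uk|exact: Kb].
have [kd|dk] := ltnP k d; last first.
  by apply: IHk => // i ki; move: (ltn_ord i); rewrite ltnNge (leq_trans dk ki).
pose j := Ordinal kd.
have /andP[uj0 uj1] := um j.
rewrite (set_coord_conv u j (m ord0 j)%:~R) affine_map_conv.
apply: Kconv; [| |lra|lra]; apply: IHk.
- by apply: set_coord_cube => //; apply/andP; split; lra.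
- move=> i; rewrite mxE; case: eqP => [->|/eqP ij] ki; first by right.
  by apply: uk; rewrite ltn_neqAle ki andbT eq_sym.
- by apply: set_coord_cube => //; apply/andP; split; lra.
- move=> i; rewrite mxE; case: eqP => [->|/eqP ij] ki; first by left.
  by apply: uk; rewrite ltn_neqAle ki andbT eq_sym.
Qed.

Lemma affine_cube_convex m : @convex_set R E (D @` cube R m).
Proof.
apply/convex_setP => _ _ l [x xm <-] [y ym <-] l0 l1.
exists (l *: x + (1 - l) *: y); last exact: affine_map_conv.
move=> i; rewrite !mxE; have /andP[? ?] := xm i; have /andP[? ?] := ym i.
by apply/andP; split; nra.
Qed.

Lemma affine_cube_polytope m : convex_polytope (D @` cube R m).
Proof.
exists [set D (ivec R (corner m b)) | b in setT].
  exact/finite_image/finite_finset.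
apply/seteqP; split.
  move=> x Tx K [Kconv VK]; move: x Tx; apply: affine_cube_sub_convex => // b.
  by apply: VK; exists b.
apply: smallest_sub; first exact: affine_cube_convex.
by move=> _ [b _ <-]; exists (ivec R (corner m b)) => //; exact: corner_cube.
Qed.

Lemma dotpZDr (c x y : E) (l : R) :
  dotp c (l *: x + (1 - l) *: y) = l * dotp c x + (1 - l) * dotp c y.
Proof.
rewrite /dotp !mulr_sumr -big_split /=; apply: eq_bigr => i _.
by rewrite !mxE; ring.
Qed.

(** A face that meets the interior of a segment of the polytope contains it. *)
Lemma face_segment (F P : set E) x y (l : R) : face F P -> P x -> P y ->
  0 < l -> l < 1 -> F (l *: x + (1 - l) *: y) -> F x /\ F y.
Proof.
move=> [c [b [cb ->]]] Px Py l0 l1 [_ /=]; rewrite dotpZDr => e.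
have := cb _ Px; have := cb _ Py => h1 h2.
by split; split=> //=; nra.
Qed.

Lemma affine_cube_vertex m x : injective D ->
  polytope_vertex (D @` cube R m) x -> exists b, x = D (ivec R (corner m b)).
Proof.
move=> Dinj xv; have [c [b0 [_ xe]]] := xv.
have [[u um ux] _] : (D @` cube R m `&` [set y | dotp c y = b0]) x.
  by rewrite -xe.
suff /cornerP[b ub] : forall i,
    u ord0 i = (m ord0 i)%:~R \/ u ord0 i = (m ord0 i)%:~R + 1.
  by exists b; rewrite -ux ub.
move=> i; have /andP[u0 u1] := um i.
have [|/eqP u0'] := eqVneq (u ord0 i) (m ord0 i)%:~R; first by left.
have [|/eqP u1'] := eqVneq (u ord0 i) ((m ord0 i)%:~R + 1); first by right.
pose v r := set_coord u i ((m ord0 i)%:~R + r).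
have vm r : 0 <= r <= 1 -> (D @` cube R m) (D (v r)).
  move=> /andP[r0 r1]; exists (v r) => //; apply: set_coord_cube => //.
  by apply/andP; split; lra.
have v0 : v 0 = set_coord u i (m ord0 i)%:~R by rewrite /v addr0.
have [] := face_segment (l := u ord0 i - (m ord0 i)%:~R) xv (vm 1 _) (vm 0 _).
- by apply/andP; split; lra.
- by apply/andP; split; lra.
- by move/eqP: u0'; rewrite subr_gt0 lt_neqAle eq_sym => ->.
- by move/eqP: u1'; rewrite ltrBlDl lt_neqAle => ->.
- by rewrite -affine_map_conv v0 -set_coord_conv -ux.
move=> /= <- /Dinj /rowP /(_ i); rewrite !mxE eqxx.
by move/eqP; rewrite addr0 eq_sym eqD1F.
Qed.

Lemma affine_cube_shift_inj m (a b : E) : A \in unitmx ->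
  [set x + a | x in D @` cube R m] = [set x + b | x in D @` cube R m] -> a = b.
Proof.
move=> Au ab.
suff H (v w : E) : [set x + v | x in D @` cube R m] `<=`
    [set x + w | x in D @` cube R m] -> forall i,
    0 <= ((v - w) *m invmx A) ord0 i.
  have : (a - b) *m invmx A = 0.
    apply/rowP => i; rewrite [RHS]mxE; apply/eqP; rewrite eq_le; apply/andP; split.
      rewrite -oppr_ge0; have := @H b a; rewrite ab => /(_ (@subset_refl _ _) i).
      by rewrite -opprB mulNmx mxE.
    by apply: H; rewrite ab.
  by move=> /(congr1 (mulmx^~ A)); rewrite mulmxKV// mul0mx => /subr0_eq.
move=> vw i.
have [_ [z zm <-]] : [set x + w | x in D @` cube R m] (D (ivec R m) + v).
  by apply: vw; exists (D (ivec R m)) => //;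
    exists (ivec R m) => //; exact: ivec_cube.
move=> zw; have -> : v - w = (z - ivec R m) *m A.
  transitivity (D z - D (ivec R m)).
    by apply/eqP; rewrite subr_eq addrAC eq_sym subr_eq zw addrC.
  by rewrite /affine_map mulmxBl opprD addrACA subrr add0r.
rewrite mulmxK // !mxE subr_ge0; by have /andP[] := zm i.
Qed.

End AffineCubePolytopes.

(** * The lattice basis and its isometries *)

Section LatticeCoordinates.
Variables (R : realType) (n : nat).
Local Notation E := 'rV[R]_n.+1.
Implicit Types (x y s t : E) (i j : 'I_n.+1).

(** The sum of the horizontal coordinates. *)
Definition hsum (x : E) : R := \sum_(i < n.+1 | i != ord0) x ord0 i.

(** The Euclidean inner product of two vectors given by their coordinates with
    respect to (e_0, ..., e_n). *)
Definition bform (x y : E) : R := dotp x y + hsum x * hsum y / 3.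

Lemma hsumD x y : hsum (x + y) = hsum x + hsum y.
Proof. by rewrite -big_split /=; apply: eq_bigr => i _; rewrite mxE. Qed.

Lemma hsumZ a x : hsum (a *: x) = a * hsum x.
Proof. by rewrite mulr_sumr; apply: eq_bigr => i _; rewrite mxE. Qed.

Lemma hsum_delta i : i != ord0 -> hsum (delta_mx ord0 i) = 1.
Proof.
move=> i0; rewrite /hsum (bigD1 i) //= mxE !eqxx big1 ?addr0 // => j.
by case/andP=> _ /negbTE ji; rewrite mxE ji andbF.
Qed.

Lemma hsum_bool : hsum (const_mx 1) = n%:R.
Proof.
rewrite /hsum (eq_bigr (fun=> 1)); last by move=> i _; rewrite mxE.
by rewrite sumr_const (@eq_card _ _ (predC1 ord0)) ?cardC1 ?card_ord.
Qed.

Lemma dotpC x y : dotp x y = dotp y x.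
Proof. by apply: eq_bigr => i _; rewrite mulrC. Qed.

Lemma dotpDl x y s : dotp (x + y) s = dotp x s + dotp y s.
Proof. by rewrite -big_split; apply: eq_bigr => i _; rewrite mxE mulrDl. Qed.

Lemma dotpZl a x s : dotp (a *: x) s = a * dotp x s.
Proof. by rewrite mulr_sumr; apply: eq_bigr => i _; rewrite mxE mulrA. Qed.

Lemma dotp_delta i x : dotp (delta_mx ord0 i) x = x ord0 i.
Proof.
rewrite /dotp (bigD1 i) //= mxE !eqxx mul1r big1 ?addr0 // => j /negbTE ji.
by rewrite mxE ji andbF mul0r.
Qed.

Lemma bformC x y : bform x y = bform y x.
Proof. by rewrite /bform dotpC [hsum x * _]mulrC. Qed.

Lemma bformDl x y s : bform (x + y) s = bform x s + bform y s.
Proof. by rewrite /bform dotpDl hsumD; ring. Qed.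

Lemma bformZl a x s : bform (a *: x) s = a * bform x s.
Proof. by rewrite /bform dotpZl hsumZ; ring. Qed.

(** * A basis with Gram form [bform] *)

(** The rows of this matrix are the basis vectors, for the value of [c] given in
    [dotp_basis_mx]. *)
Definition basis_mx (c : R) : 'M[R]_n.+1 :=
  \matrix_(i, j) ((i == j)%:R + c * ((i != ord0) && (j != ord0))%:R).

Lemma mul_basis_mx c x j :
  (x *m basis_mx c) ord0 j = x ord0 j + c * hsum x * (j != ord0)%:R.
Proof.
rewrite mxE; under eq_bigr do rewrite mxE mulrDr.
rewrite big_split /=; congr (_ + _).
  rewrite (bigD1 j) //= eqxx mulr1 big1 ?addr0 // => i /negbTE ->.
  by rewrite mulr0.
rewrite /hsum mulr_sumr mulr_suml [RHS]big_mkcond /=; apply: eq_bigr => i _.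
by case: (i != ord0); case: (j != ord0); rewrite /=; ring.
Qed.

Lemma hsum_basis_mx c x : hsum (x *m basis_mx c) = (1 + c * n%:R) * hsum x.
Proof.
transitivity (hsum x + c * hsum x * n%:R); last by ring.
rewrite -hsum_bool [X in _ = _ + X]mulr_sumr -big_split /=.
by apply: eq_bigr => k k0; rewrite mul_basis_mx k0 mxE.
Qed.

Lemma dotp_basis_mx c x y : n%:R * c ^+ 2 + 2 * c = 3^-1 ->
  dotp (x *m basis_mx c) (y *m basis_mx c) = bform x y.
Proof.
move=> cE; rewrite /bform [_ * _ / 3]mulrC -{}cE.
pose w (z : E) := c * hsum z.
transitivity (dotp x y + w x * hsum y + w y * hsum x + w x * w y * n%:R).
  rewrite -hsum_bool /hsum !mulr_sumr /dotp.
  rewrite [X in _ + X + _ + _]big_mkcond [X in _ + _ + X + _]big_mkcond.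
  rewrite [X in _ + _ + _ + X]big_mkcond -!big_split /=.
  apply: eq_bigr => i _; rewrite !mul_basis_mx mxE -/(w x) -/(w y).
  by case: (i != ord0) => /=; ring.
by rewrite /w; ring.
Qed.

Lemma basis_exists : exists2 B : 'M[R]_n.+1, B \in unitmx &
  forall x y, dotp (x *m B) (y *m B) = bform x y.
Proof.
have [c c0 cE] : exists2 c : R, 0 <= c & n%:R * c ^+ 2 + 2 * c = 3^-1.
  have [->|n0] := posnP n; first by exists (6^-1); lra.
  have nR : (0 : R) < n%:R by rewrite ltr0n.
  pose r := Num.sqrt (1 + n%:R / 3 : R).
  have r2 : r ^+ 2 = 1 + n%:R / 3 by rewrite sqr_sqrtr; lra.
  have r1 : 1 <= r by rewrite -[1]sqrtr1; apply: ler_wsqrtr; lra.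
  exists ((r - 1) / n%:R); first by rewrite divr_ge0 ?ler0n // subr_ge0.
  have -> : n%:R * ((r - 1) / n%:R) ^+ 2 + 2 * ((r - 1) / n%:R) =
      (r ^+ 2 - 1) / n%:R by field; lra.
  by rewrite r2; field; lra.
exists (basis_mx c); last by move=> x y; exact: dotp_basis_mx.
have nc : 1 + c * n%:R != 0 by rewrite gt_eqF // ltr_pwDl // mulr_ge0.
suff /mulmx1_unit[] : basis_mx c *m basis_mx (- c / (1 + c * n%:R)) = 1%:M by [].
apply/row_matrixP => i; rewrite !rowE mulmx1 mulmxA.
by apply/rowP => j; rewrite !mul_basis_mx hsum_basis_mx; field.
Qed.

(** * Isometries in lattice coordinates *)

(** Linear isometries, in lattice coordinates. *)
Definition bform_preserving (M : 'M[R]_n.+1) : Prop :=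
  forall x y, bform (x *m M) (y *m M) = bform x y.

(** Affine isometries, in lattice coordinates. *)
Definition bform_isometry (f : E -> E) : Prop :=
  exists M t, bform_preserving M /\ f = affine_map M t.

Lemma affine_map_comp (d : nat) (M N : 'M[R]_d) (t u : 'rV[R]_d) :
  affine_map M t \o affine_map N u = affine_map (N *m M) (t + u *m M).
Proof.
by apply/funext => x; rewrite /affine_map /= mulmxDl addrA mulmxA.
Qed.

Lemma bform_isometry_id : bform_isometry id.
Proof.
exists 1%:M, 0; split=> [x y|]; first by rewrite !mulmx1.
by apply/funext => x; rewrite /affine_map mulmx1 add0r.
Qed.

Lemma bform_isometry_comp f g :
  bform_isometry f -> bform_isometry g -> bform_isometry (f \o g).
Proof.
move=> [M [t [hM ->]]] [N [u [hN ->]]]; rewrite affine_map_comp.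
exists (N *m M), (t + u *m M); split=> [x y|//].
by rewrite !mulmxA hM hN.
Qed.

Lemma orthogonal_dotp (Q : 'M[R]_n.+1) :
  (forall x y, dotp (x *m Q) (y *m Q) = dotp x y) -> orthogonal_group Q.
Proof.
move=> h; apply/matrixP => a b; rewrite !mxE.
transitivity (dotp (row a Q) (row b Q)).
  by apply: eq_bigr => k _; rewrite !mxE.
by rewrite !rowE h dotp_delta mxE /= eq_sym.
Qed.

Lemma bform_preserving_conj (B M : 'M[R]_n.+1) : B \in unitmx ->
  (forall x y, dotp (x *m B) (y *m B) = bform x y) -> bform_preserving M ->
  orthogonal_group (invmx B *m M *m B).
Proof.
move=> Bu hB hM; apply: orthogonal_dotp => x y.
by rewrite !mulmxA hB hM -hB !mulmxKV.
Qed.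

(** * Signed permutations *)

(** The sign of coordinate [j]: [e0] holds if the vertical coordinate is
    negated, [e] if the horizontal ones are. *)
Definition sg (e0 e : bool) (j : 'I_n.+1) : R :=
  (-1) ^+ (if j == ord0 then e0 else e).

Lemma sgK e0 e j : sg e0 e j * sg e0 e j = 1.
Proof. by rewrite -expr2 sqrr_sign. Qed.

(** The permutation [p] of the coordinates, followed by these changes of signs
    and the translation by the integer vector [u]. *)
Definition signed_perm (e0 e : bool) (p : {perm 'I_n.+1}) (u : 'rV[int]_n.+1)
    (s : E) : E :=
  \row_j (sg e0 e j * s ord0 (p j) + (u ord0 j)%:~R).

(** The linear part of [signed_perm]. *)
Definition signed_perm_mx (e0 e : bool) (p : {perm 'I_n.+1}) : 'M[R]_n.+1 :=
  \matrix_(a, b) (sg e0 e b * (a == p b)%:R).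

Lemma mul_signed_perm_mx e0 e p x j :
  (x *m signed_perm_mx e0 e p) ord0 j = sg e0 e j * x ord0 (p j).
Proof.
rewrite mxE (bigD1 (p j)) //= !mxE eqxx mulr1 mulrC big1 ?addr0 // => k.
by move=> /negbTE kp; rewrite mxE kp !mulr0.
Qed.

Lemma signed_permE e0 e p u :
  signed_perm e0 e p u = affine_map (signed_perm_mx e0 e p) (ivec R u).
Proof.
apply/funext => s; apply/rowP => j.
by rewrite !mxE -mul_signed_perm_mx mxE addrC.
Qed.

Lemma hsum_signed_perm e0 e (p : {perm 'I_n.+1}) x : p ord0 = ord0 ->
  hsum (x *m signed_perm_mx e0 e p) = (-1) ^+ e * hsum x.
Proof.
move=> p0; rewrite [in RHS]/hsum (reindex_inj (@perm_inj _ p)) mulr_sumr.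
apply: eq_big => [j|j /negbTE j0]; last by rewrite mul_signed_perm_mx /sg j0.
by rewrite -[in RHS]p0 (inj_eq perm_inj).
Qed.

Lemma signed_perm_preserving e0 e (p : {perm 'I_n.+1}) : p ord0 = ord0 ->
  bform_preserving (signed_perm_mx e0 e p).
Proof.
move=> p0 x y; rewrite /bform !hsum_signed_perm // mulrACA -expr2 sqrr_sign mul1r.
congr (_ + _); rewrite [in RHS]/dotp (reindex_inj (@perm_inj _ p)).
apply: eq_bigr => j _; rewrite !mul_signed_perm_mx mulrACA.
by rewrite sgK mul1r.
Qed.

Lemma signed_perm_isometry e0 e (p : {perm 'I_n.+1}) u : p ord0 = ord0 ->
  bform_isometry (signed_perm e0 e p u).
Proof.
move=> p0; exists (signed_perm_mx e0 e p), (ivec R u).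
by split; [exact: signed_perm_preserving|exact: signed_permE].
Qed.

(** * Reflections *)

(** The reflection along the basis vector of index [i] subtracts [coef i x]
    times this vector from [x], when [i] is horizontal. *)
Definition coef i x : R := 3 / 2 * x ord0 i + hsum x / 2.

Definition lin_refl i x : E := x - coef i x *: delta_mx ord0 i.

(** The reflection along the basis vector of index [i] that takes the origin to
    the point at a quarter of this vector. *)
Definition refl i x : E := x - (coef i x - 4^-1) *: delta_mx ord0 i.

(** The matrix of [lin_refl]. *)
Definition refl_mx i : 'M[R]_n.+1 :=
  1%:M - (\col_a (3 / 2 * (a == i)%:R + (a != ord0)%:R / 2)) *m delta_mx ord0 i.

Lemma coefD i x y : coef i (x + y) = coef i x + coef i y.
Proof. by rewrite /coef hsumD mxE; ring. Qed.

Lemma coefZ i a x : coef i (a *: x) = a * coef i x.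
Proof. by rewrite /coef hsumZ mxE; ring. Qed.

Lemma coef_delta i j : i != ord0 -> j != ord0 ->
  coef i (delta_mx ord0 j) = if i == j then 2 else 2^-1.
Proof.
by move=> i0 j0; rewrite /coef hsum_delta // mxE /=; case: (i == j) => /=; field.
Qed.

Lemma bform_delta i x : i != ord0 -> bform (delta_mx ord0 i) x = 2 / 3 * coef i x.
Proof. by move=> i0; rewrite /bform /coef dotp_delta hsum_delta //; field. Qed.

Lemma mul_refl_mx i x : x *m refl_mx i = lin_refl i x.
Proof.
rewrite mulmxBr mulmx1 mulmxA; congr (_ - _).
rewrite [x *m _]mx11_scalar mul_scalar_mx; congr (_ *: _).
rewrite mxE /coef; under eq_bigr do rewrite mxE mulrDr.
rewrite big_split /=; congr (_ + _).
  rewrite (bigD1 i) //= eqxx big1 ?addr0 => [|j /negbTE ->].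
    by rewrite mulr1 mulrC.
  by rewrite !mulr0.
rewrite mulr_suml [RHS]big_mkcond /=; apply: eq_bigr => j _.
by case: (j != ord0); rewrite /= ?mul1r // mul0r mulr0.
Qed.

Lemma reflE i : refl i = affine_map (refl_mx i) (4^-1 *: delta_mx ord0 i).
Proof.
apply/funext => x; rewrite /affine_map mul_refl_mx /lin_refl /refl.
by rewrite scalerBl opprB addrCA addrA.
Qed.

Lemma bform_lin_refl i x y : i != ord0 ->
  bform (lin_refl i x) (lin_refl i y) = bform x y.
Proof.
move=> i0; rewrite /lin_refl -!scaleNr bformDl bformZl bform_delta //.
rewrite !(bformC _ (y + _)) !bformDl !bformZl bform_delta // coefD coefZ.
by rewrite coef_delta // eqxx (bformC y); ring.
Qed.

Lemma refl_mx_preserving i : i != ord0 -> bform_preserving (refl_mx i).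
Proof. by move=> i0 x y; rewrite !mul_refl_mx bform_lin_refl. Qed.

Lemma refl_isometry i : i != ord0 -> bform_isometry (refl i).
Proof.
move=> i0; exists (refl_mx i), (4^-1 *: delta_mx ord0 i).
by split; [exact: refl_mx_preserving|exact: reflE].
Qed.

Lemma addZZ_eq (x v : E) (a b : R) : a + b = 0 -> x + a *: v + b *: v = x.
Proof. by move=> ab; rewrite -addrA -scalerDl ab scale0r addr0. Qed.

Lemma lin_reflK i : i != ord0 -> involutive (lin_refl i).
Proof.
move=> i0 x; rewrite {1}/lin_refl /lin_refl -!scaleNr coefD coefZ coef_delta //.
by rewrite eqxx; apply: addZZ_eq; ring.
Qed.

Lemma reflK i : i != ord0 -> involutive (refl i).
Proof.
move=> i0 x; rewrite {1}/refl /refl -!scaleNr coefD coefZ coef_delta //.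
by rewrite eqxx; apply: addZZ_eq; ring.
Qed.

Lemma refl_ord0 i x : i != ord0 -> refl i x ord0 ord0 = x ord0 ord0.
Proof.
move=> /negbTE i0; rewrite !mxE eq_sym i0 andbF mulr0; exact: subr0.
Qed.

End LatticeCoordinates.

(** * Layers of cubes and the interface of two layers *)

Section Layers.
Variables (R : realType) (n : nat).
Local Notation E := 'rV[R]_n.+1.
Implicit Types (m u w : 'rV[int]_n.+1) (i j : 'I_n.+1) (p : {perm 'I_n.+1}).

Lemma image_tiles_comp (d : nat) (f g : 'rV[R]_d -> 'rV[R]_d) tau :
  image_tiles (f \o g) tau = image_tiles f (image_tiles g tau).
Proof.
apply/seteqP; split=> [_ [T tauT <-]|_ [_ [T tauT <-] <-]].
  by exists (g @` T); [exists T|rewrite -image_comp].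
by exists T => //; rewrite -image_comp.
Qed.

Lemma image_tilesU (d : nat) (f : 'rV[R]_d -> 'rV[R]_d) tau1 tau2 :
  image_tiles f (tau1 `|` tau2) = image_tiles f tau1 `|` image_tiles f tau2.
Proof. exact: image_setU. Qed.

(** The cubes between the heights [k] and [k + 1]. *)
Definition cube_layer (k : int) : set (set E) :=
  [set cube R m | m in [set m : 'rV[int]_n.+1 | m ord0 ord0 = k]].

(** The index of the image of [cube m] under a signed permutation. *)
Definition signed_perm_index (e0 e : bool) p u m : 'rV[int]_n.+1 :=
  \row_j (u ord0 j + (if (if j == ord0 then e0 else e) then - m ord0 (p j) - 1
                      else m ord0 (p j))).

Lemma signed_perm_cube e0 e p u m :
  signed_perm e0 e p u @` cube R m = cube R (signed_perm_index e0 e p u m).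
Proof.
apply/seteqP; split=> [_ [s sm <-] j|s sm].
  rewrite !mxE /sg intrD; have /andP[] := sm (p j).
  case: (if _ == _ then e0 else e); rewrite /= ?expr1 ?expr0 ?intrB ?intrN /=;
  by move=> ? ?; apply/andP; split; lra.
exists (\row_j (sg R e0 e (p^-1%g j) * (s ord0 (p^-1%g j)
    - (u ord0 (p^-1%g j))%:~R))).
  move=> j; rewrite mxE; have /andP[] := sm (p^-1%g j).
  rewrite !mxE permKV /sg intrD.
  case: (if _ == _ then e0 else e); rewrite /= ?expr1 ?expr0 ?intrB ?intrN /=;
  by move=> ? ?; apply/andP; split; lra.
by apply: row_ext => j; rewrite !mxE permK mulrA sgK mul1r subrK.
Qed.

Lemma signed_perm_layer e0 e p u k : p ord0 = ord0 ->
  image_tiles (signed_perm e0 e p u) (cube_layer k) =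
  cube_layer (u ord0 ord0 + (if e0 then - k - 1 else k)).
Proof.
move=> p0; apply/seteqP; split=> [_ [_ [m /= mk <-] <-]|_ [m /= mk <-]].
  rewrite signed_perm_cube; eexists; last reflexivity.
  by rewrite /= mxE eqxx p0 mk.
pose m' : 'rV[int]_n.+1 := \row_j
  (if (if p^-1%g j == ord0 then e0 else e)
   then - (m ord0 (p^-1%g j) - u ord0 (p^-1%g j)) - 1
   else m ord0 (p^-1%g j) - u ord0 (p^-1%g j)).
exists (cube R m').
  exists m' => //=; rewrite mxE.
  have -> : p^-1%g ord0 = ord0 by apply: (@perm_inj _ p); rewrite permKV.
  by rewrite mk eqxx; case: (e0) => /=; lia.
rewrite signed_perm_cube; congr cube; apply: row_ext => j; rewrite !mxE permK.
by case: (if _ == _ then e0 else e) => /=; lia.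
Qed.

(** Compatibility of the reflections with the symmetries of the cube lattice.
    The condition says that [e] is the parity of a coordinate sum of [u]: for an
    even sum the translation by [u] is also a symmetry of the reflected lattice,
    for an odd sum its composition with a central symmetry is. *)
Lemma refl_signed_perm i0 i (e0 e : bool) p u (q : int) : i0 != ord0 -> i != ord0 ->
  p i = i0 -> p ord0 = ord0 ->
  \sum_(j < n.+1 | (j != ord0) && (j != i)) u ord0 j = 2 * q + e%:Z ->
  let w := \row_j (if j == i then - u ord0 i - q else u ord0 j) in
  signed_perm e0 e p u \o refl i0 = refl (R := R) i \o signed_perm e0 e p w.
Proof.
move=> i00 i_0 pi p0 uq w.
have cw : coef i (ivec R w) = - 2 * (u ord0 i)%:~R - q%:~R + e%:R / 2.
  rewrite /coef /hsum (bigD1 i) //= !ivecE mxE eqxx.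
  rewrite (eq_bigr (fun j => (u ord0 j)%:~R)); last first.
    by move=> j /andP[_ /negbTE ji]; rewrite ivecE mxE ji.
  by rewrite -rmorph_sum /= uq !intrD intrM intrN; case: (e) => /=; lra.
have cs s : coef i (s *m signed_perm_mx R e0 e p) = (-1) ^+ e * coef i0 s.
  rewrite /coef hsum_signed_perm // mul_signed_perm_mx pi /sg (negbTE i_0).
  by ring.
have cB (s : E) : coef i (signed_perm e0 e p w s) =
    (- 2 * (u ord0 i)%:~R - q%:~R + e%:R / 2) + (-1) ^+ e * coef i0 s.
  by rewrite signed_permE /affine_map coefD cw cs.
apply/funext => s; apply: row_ext => j /=; rewrite /refl cB !mxE -[in _ == i0]pi.
rewrite (inj_eq perm_inj) eqxx /=; case: eqP => [->|_]; rewrite /= ?mulr1 ?mulr0.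
  rewrite intrD !intrN /sg (negbTE i_0) pi.
  by case: (e); rewrite /= ?expr1 ?expr0; lra.
by rewrite !subr0.
Qed.

(** The two layers of tiles that meet at height 0 when the upper layer is the
    mirror image of a cube layer in the reflection [refl i]. *)
Definition interface i : set (set E) :=
  cube_layer (-1) `|` image_tiles (refl i) (cube_layer 0).

(** Every lattice point is a vertex of the same kind: a symmetry of the cube
    lattice takes the origin to it and [interface i0] to two layers of the
    same relative position, stacked upside down when [e0] holds. *)
Lemma interface_move i0 i (e0 : bool) u : i0 != ord0 -> i != ord0 ->
  exists A, [/\ bform_isometry A, A 0 = ivec R u,
    image_tiles A (cube_layer (-1)) =
      cube_layer (if e0 then u ord0 ord0 else u ord0 ord0 - 1) &
    image_tiles A (image_tiles (refl i0) (cube_layer 0)) =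
      image_tiles (refl i)
        (cube_layer (if e0 then u ord0 ord0 - 1 else u ord0 ord0))].
Proof.
move=> i00 i_0; pose p := tperm i i0.
have p0 : p ord0 = ord0 by rewrite tpermD.
pose z := \sum_(j < n.+1 | (j != ord0) && (j != i)) u ord0 j.
have [q [e zE]] : exists q (e : bool), z = 2 * q + e%:Z.
  by exists (z %/ 2)%Z, ((z %% 2)%Z == 1); lia.
exists (signed_perm e0 e p u); split.
- exact: signed_perm_isometry.
- by apply: row_ext => j; rewrite !mxE mulr0 add0r.
- by rewrite signed_perm_layer //; congr cube_layer; case: e0; lia.
rewrite -image_tiles_comp (refl_signed_perm e0 i00 i_0 (tpermL _ _) p0 zE).
rewrite image_tiles_comp signed_perm_layer // mxE eq_sym (negbTE i_0).
by congr (image_tiles _ (cube_layer _)); case: e0; lia.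
Qed.

(** Exchanging two horizontal coordinates other than [i0] is a symmetry of the
    interface that fixes the origin; as a transposition, it reverses
    orientation. *)
Lemma interface_swap i0 a b : i0 != ord0 -> a != ord0 -> b != ord0 ->
  a != i0 -> b != i0 ->
  image_tiles (signed_perm false false (tperm a b) 0) (interface i0)
  = interface i0.
Proof.
move=> i00 a0 b0 ai bi; have p0 : tperm a b ord0 = ord0 by rewrite tpermD.
have pi : tperm a b i0 = i0 by rewrite tpermD.
rewrite image_tilesU -image_tiles_comp.
rewrite (refl_signed_perm (q := 0) false i00 i00 pi p0); last first.
  by rewrite big1 // => j _; rewrite mxE.
by rewrite image_tiles_comp !signed_perm_layer // !mxE if_same.
Qed.

(** * Stacks of layers, each the mirror image of the previous one *)

Variable ix : nat -> 'I_n.+1.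
Hypothesis ix0 : forall k, ix k != ord0.

(** The position of the layer with number [k], in lattice coordinates: the
    layer [k.+1] is the mirror image of the layer [k] in its own reflection of
    index [ix k]. *)
Fixpoint place (k : nat) : E -> E :=
  if k is k'.+1 then place k' \o refl (ix k') else id.

(** The inverse of [place]. *)
Fixpoint unplace (k : nat) : E -> E :=
  if k is k'.+1 then refl (ix k') \o unplace k' else id.

Lemma unplaceK k : cancel (unplace k) (place k).
Proof. by elim: k => //= k IHk x /=; rewrite reflK. Qed.

Lemma place_ord0 k x : place k x ord0 ord0 = x ord0 ord0.
Proof. by elim: k x => //= k IHk x; rewrite IHk refl_ord0. Qed.

Lemma unplace_ord0 k x : unplace k x ord0 ord0 = x ord0 ord0.
Proof. by rewrite -[in RHS](unplaceK k x) place_ord0. Qed.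

Lemma place_isometry k : bform_isometry (place k).
Proof.
elim: k => [|k IHk]; first exact: bform_isometry_id.
by apply: bform_isometry_comp => //; exact: refl_isometry.
Qed.

(** The layer of the stack between the heights [k] and [k + 1]; the stack is
    symmetric about height 1/2. *)
Definition stack_layer (k : int) : set (set E) :=
  image_tiles (place `|k|) (cube_layer k).

(** An isometry takes the origin to any given vertex of the stack and the
    standard interface to the two layers that meet at this vertex. *)
Lemma stack_vertex i0 u (l : int) : i0 != ord0 ->
  l = u ord0 ord0 - 1 \/ l = u ord0 ord0 ->
  exists F, [/\ bform_isometry F, F 0 = place `|l| (ivec R u) &
    image_tiles F (interface i0) =
      stack_layer (u ord0 ord0 - 1) `|` stack_layer (u ord0 ord0)].
Proof.
move=> i00; rewrite /stack_layer.
set k := u ord0 ord0.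
have stackU (j : nat) (e0 : bool) i A : image_tiles A (cube_layer (-1)) =
      cube_layer (if e0 then k else k - 1) ->
    image_tiles A (image_tiles (refl i0) (cube_layer 0)) =
      image_tiles (refl i) (cube_layer (if e0 then k - 1 else k)) ->
  image_tiles (place j \o A) (interface i0) =
    image_tiles (place j) (cube_layer (if e0 then k else k - 1)) `|`
    image_tiles (place j \o refl i) (cube_layer (if e0 then k - 1 else k)).
  move=> A1 A2; rewrite (image_tiles_comp _ A) (image_tiles_comp _ (refl i)).
  by rewrite image_tilesU A1 A2 image_tilesU.
have stackV (j : nat) (e0 : bool) A : image_tiles A (cube_layer (-1)) =
      cube_layer (if e0 then k else k - 1) ->
    image_tiles A (image_tiles (refl i0) (cube_layer 0)) =
      image_tiles (refl (ix j)) (cube_layer (if e0 then k - 1 else k)) ->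
  image_tiles (place j.+1 \o A) (interface i0) =
    image_tiles (place j.+1) (cube_layer (if e0 then k else k - 1)) `|`
    image_tiles (place j) (cube_layer (if e0 then k - 1 else k)).
  move=> A1 A2; rewrite (stackU j.+1 e0 (ix j)) //=; congr (_ `|` _).
  congr image_tiles; apply/funext => x /=; rewrite reflK //.
have [k1|k0] := leP 1 k.
  have [j jk] : exists j : nat, k - 1 = j by exists `|k - 1|%N; lia.
  have -> : `|k - 1|%N = j by lia.
  have -> : `|k|%N = j.+1 by lia.
  case=> ->.
    have [A [Ai A0 A1 A2]] := interface_move false u i00 (ix0 j).
    exists (place j \o A); split; last exact: (stackU j false (ix j) A A1 A2).
      exact: bform_isometry_comp (place_isometry j) Ai.
    by rewrite (_ : `|_|%N = j) /= ?A0 //; lia.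
  have [A [Ai A0 A1 A2]] := interface_move true u i00 (ix0 j).
  exists (place j.+1 \o A); split.
  - exact: bform_isometry_comp (place_isometry j.+1) Ai.
  - by rewrite (_ : `|_|%N = j.+1) /= ?A0 //; lia.
  - by rewrite setUC; exact: (stackV j true A A1 A2).
have [j jk] : exists j : nat, k = - j%:Z by exists `|k|%N; lia.
have -> : `|k - 1|%N = j.+1 by lia.
have -> : `|k|%N = j by lia.
case=> ->.
  have [A [Ai A0 A1 A2]] := interface_move false u i00 (ix0 j).
  exists (place j.+1 \o A); split; last exact: (stackV j false A A1 A2).
    exact: bform_isometry_comp (place_isometry j.+1) Ai.
  by rewrite (_ : `|_|%N = j.+1) /= ?A0 //; lia.
have [A [Ai A0 A1 A2]] := interface_move true u i00 (ix0 j).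
exists (place j \o A); split.
- exact: bform_isometry_comp (place_isometry j) Ai.
- by rewrite (_ : `|_|%N = j) /= ?A0 //; lia.
- by rewrite setUC; exact: (stackU j true (ix j) A A1 A2).
Qed.

End Layers.

(** * The lattices of the layers have no common translation *)

(** The recurrence makes every term twice an integer combination of its two
    neighbours, so the powers of 2 that divide the terms grow away from the
    ends of the interval. *)
Lemma dyadic_decay (c : nat -> int) (a N : nat) :
  (forall t, (a <= t)%N -> (t + 2 < a + N)%N ->
     2 * c t.+2 + c t.+1 + 2 * c t = 0) ->
  forall e t, (a + e <= t)%N -> (t + e < a + N)%N -> (2 ^+ e %| c t)%Z.
Proof.
move=> rec; elim=> [|e IHe] t at_ tN; first by rewrite expr0 dvd1z.
case: t at_ tN => [|t] at_ tN; first by lia.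
have /dvdzP[x xE] := IHe t ltac:(lia) ltac:(lia).
have /dvdzP[y yE] := IHe t.+2 ltac:(lia) ltac:(lia).
have := rec t ltac:(lia) ltac:(lia); rewrite xE yE => cE.
apply/dvdzP; exists (- y - x); rewrite exprS.
by move: (2 ^+ e) cE => z; lia.
Qed.

(** By [dyadic_decay] the terms in the middle of the interval vanish, and the
    recurrence carries this to both ends. *)
Lemma dyadic_vanish (c : nat -> int) (a N e : nat) :
  (forall t, (a <= t)%N -> (t + 2 < a + N)%N ->
     2 * c t.+2 + c t.+1 + 2 * c t = 0) ->
  (e.*2 + 2 <= N)%N ->
  (forall t, (a <= t)%N -> (t < a + N)%N -> `|c t| < 2 ^+ e) ->
  forall t, (a <= t)%N -> (t < a + N)%N -> c t = 0.
Proof.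
move=> rec Ne bnd.
have mid t : (a + e <= t)%N -> (t + e < a + N)%N -> c t = 0.
  move=> at_ tN; have /dvdzP[x xE] := dyadic_decay rec at_ tN.
  have := bnd t ltac:(lia) ltac:(lia); rewrite xE normrM.
  have e0 : 0 < 2 ^+ e :> int by rewrite exprn_gt0.
  rewrite (gtr0_norm e0) gtr_pMl // => x1.
  have -> : x = 0 by lia.
  by rewrite mul0r.
have up k : (a + e + k + 1 < a + N)%N -> c (a + e + k)%N = 0 /\ c (a + e + k).+1 = 0.
  elim: k => [|k IHk] kN; first by split; apply: mid; lia.
  have [c1 c2] := IHk ltac:(lia); rewrite addnS; split=> //.
  have := rec (a + e + k)%N ltac:(lia) ltac:(lia); lia.
have down k : (k <= e)%N -> c (a + e - k)%N = 0 /\ c (a + e - k).+1 = 0.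
  elim: k => [|k IHk] kN; first by rewrite subn0; split; apply: mid; lia.
  have [c1 c2] := IHk ltac:(lia).
  have E1 : (a + e - k.+1).+1 = (a + e - k)%N by lia.
  rewrite E1; split=> //.
  have := rec (a + e - k.+1)%N ltac:(lia) ltac:(lia); rewrite E1; lia.
move=> t at_ tN; have [te|et] := leqP (a + e) t.
  have [|] := leqP (t + 2) (a + N).
    move=> tN'; have [] := up (t - (a + e))%N ltac:(lia).
    by rewrite subnKC.
  move=> tN'; have [_] := up (t - (a + e) - 1)%N ltac:(lia).
  by rewrite (_ : (_ + _).+1 = t) //; lia.
have [] := down (a + e - t)%N ltac:(lia).
by rewrite subKn //; lia.
Qed.

Section Lattices.
Variables (R : realType) (n : nat).
Local Notation E := 'rV[R]_n.+1.
Implicit Types (x y z : E) (w : 'rV[int]_n.+1) (i j : 'I_n.+1).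

(** Membership in the cube lattice. *)
Definition integral (x : E) : Prop := exists w, x = ivec R w.

Lemma coef_ivec i w : 2 * coef i (ivec R w) =
  (3 * w ord0 i + \sum_(j < n.+1 | j != ord0) w ord0 j)%:~R.
Proof.
rewrite /coef ivecE intrD intrM rmorph_sum /=.
have -> : hsum (ivec R w) = \sum_(j < n.+1 | j != ord0) (w ord0 j)%:~R.
  by apply: eq_bigr => j _; rewrite ivecE.
by field.
Qed.

Lemma lin_refl_double i w :
  integral (lin_refl i (2 *: ivec R w)).
Proof.
exists (2 *: w - (3 * w ord0 i + \sum_(j < n.+1 | j != ord0) w ord0 j) *:
  delta_mx ord0 i).
apply: row_ext => j; rewrite /lin_refl coefZ coef_ivec !mxE.
by rewrite [RHS]intrB 2!intrM; case: (j == i).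
Qed.

Lemma lin_refl_coef i x : integral x -> integral (lin_refl i x) ->
  exists c : int, coef i x = c%:~R.
Proof.
move=> [v ->] [w /rowP/(_ i)]; rewrite !mxE !eqxx mulr1 => e.
by exists (v ord0 i - w ord0 i); rewrite intrB -e opprB addrCA subrr addr0.
Qed.

Lemma coef_bound i x : (coef i x) ^+ 2 <= 6 * bform x x.
Proof.
have h : (x ord0 i) ^+ 2 <= dotp x x.
  rewrite /dotp (bigD1 i) //= -expr2 lerDl sumr_ge0 // => j _.
  by rewrite -expr2 sqr_ge0.
rewrite /coef /bform; move: (hsum x) (x ord0 i) (dotp x x) h => a b c h.
by nra.
Qed.

Lemma coef_eq0 x : x ord0 ord0 = 0 ->
  (forall i, i != ord0 -> coef i x = 0) -> x = 0.
Proof.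
move=> x0 cx.
have xi i : i != ord0 -> x ord0 i = - hsum x / 3.
  by move=> i0; have := cx i i0; rewrite /coef; lra.
have h0 : hsum x = 0.
  have e : hsum x = - hsum x / 3 * n%:R.
    rewrite {1}/hsum (eq_bigr _ xi) -(hsum_bool R n) [RHS]mulr_sumr.
    by apply: eq_bigr => i _; rewrite mxE mulr1.
  have n0 : 0 <= n%:R :> R by [].
  by nra.
apply: row_ext => i; rewrite [RHS]mxE; have [->|i0] := eqVneq i ord0 => //.
by rewrite xi // h0 oppr0 mul0r.
Qed.

Section LatticeSequence.
Variable ix : nat -> 'I_n.+1.
Hypothesis ix0 : forall k, ix k != ord0.

(** The linear part of [place]. *)
Fixpoint place_mx (k : nat) : 'M[R]_n.+1 :=
  if k is k'.+1 then refl_mx R (ix k') *m place_mx k' else 1%:M.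

(** The horizontal vector [x] belongs to the lattice of the layer with number
    [k] when [lin_unplace k x] is integral. *)
Fixpoint lin_unplace (k : nat) (x : E) : E :=
  if k is k'.+1 then lin_refl (ix k') (lin_unplace k' x) else x.

Lemma placeE k : place ix k = affine_map (place_mx k) (place ix k 0).
Proof.
elim: k => [|k IHk] /=.
  by apply/funext => x; rewrite /affine_map mulmx1 add0r.
rewrite {1}IHk reflE affine_map_comp; congr affine_map.
by rewrite [in RHS]IHk /affine_map mul0mx addr0.
Qed.

Lemma lin_unplace_mulK k x : lin_unplace k (x *m place_mx k) = x.
Proof.
elim: k x => [|k IHk] x /=; first by rewrite mulmx1.
by rewrite mulmxA IHk mul_refl_mx lin_reflK.
Qed.

Lemma lin_unplaceK k x : lin_unplace k x *m place_mx k = x.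
Proof.
elim: k => [|k IHk] /=; first by rewrite mulmx1.
by rewrite mulmxA mul_refl_mx lin_reflK.
Qed.

Lemma bform_lin_unplace k x : bform (lin_unplace k x) (lin_unplace k x) = bform x x.
Proof. by elim: k => //= k IHk; rewrite bform_lin_refl. Qed.

Lemma lin_unplace_ord0 k x : lin_unplace k x ord0 ord0 = x ord0 ord0.
Proof.
elim: k => //= k IHk; rewrite -IHk !mxE eq_sym (negbTE (ix0 k)) andbF mulr0.
exact: subr0.
Qed.

(** Finitely many of the lattices have a common nonzero vector. *)
Lemma common_translation (q : nat) : (0 < n)%N -> exists x,
  [/\ x ord0 ord0 = 0, x != 0 &
      forall k, (k <= q)%N -> integral (lin_unplace k x)].
Proof.
move=> n0; pose i1 : 'I_n.+1 := lift ord0 (Ordinal n0).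
exists (2 ^+ q *: delta_mx ord0 i1); split.
- by rewrite !mxE mulr0.
- apply/eqP => /rowP/(_ i1); rewrite !mxE !eqxx mulr1 => /eqP.
  by rewrite expf_eq0 pnatr_eq0 andbF.
suff H k : (k <= q)%N -> exists w,
    lin_unplace k (2 ^+ q *: delta_mx ord0 i1) = 2 ^+ (q - k) *: ivec R w.
  move=> k /H[w ->]; exists (2 ^+ (q - k) *: w).
  by apply: row_ext => j; rewrite !mxE intrM rmorphXn.
elim: k => [|k IHk] kq.
  exists (delta_mx ord0 i1); rewrite subn0; congr (_ *: _).
  by apply: row_ext => j; rewrite !mxE; case: (_ && _).
have [w /= ->] := IHk (ltnW kq).
have [v vE] := lin_refl_double (ix k) w; exists v.
rewrite (_ : q - k = (q - k.+1).+1)%N; last by lia.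
by rewrite -vE /lin_refl !coefZ exprSr -!scalerA scalerBr.
Qed.

(** A vector that belongs to all lattices is eventually fixed by all the
    reflections, provided that on each block from 2 ^ m to 2 ^ m.+1 two
    reflections alternate. *)
Lemma block_coef0 x : (forall k, integral (lin_unplace k x)) ->
  (forall m t, (2 ^ m <= t)%N -> (t + 2 < 2 ^ m + 2 ^ m)%N ->
     ix t.+2 = ix t /\ ix t.+1 != ix t) ->
  exists m0, forall t, (2 ^ m0 <= t)%N -> coef (ix t) (lin_unplace t x) = 0.
Proof.
move=> xint blk.
have cint t : exists c : int, coef (ix t) (lin_unplace t x) = c%:~R.
  by apply: lin_refl_coef => //; exact: (xint t.+1).
have [c cE] := choice cint.
have rec m t : (2 ^ m <= t)%N -> (t + 2 < 2 ^ m + 2 ^ m)%N ->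
    2 * c t.+2 + c t.+1 + 2 * c t = 0.
  move=> mt tm; have [i2 i1] := blk m t mt tm.
  apply: (@intr_inj R); rewrite !intrD !intrM -!cE i2 /= -/(lin_unplace t x).
  set z := lin_unplace t x.
  rewrite {1 2}/lin_refl -!scaleNr coefD coefZ coef_delta // eq_sym (negbTE i1).
  rewrite {1}/lin_refl -!scaleNr coefD coefZ coef_delta // eqxx.
  by field.
(* the value of the form is invariant, so one exponent serves all blocks *)
have [e eb] : exists e : nat, 6 * bform x x < (2 ^+ e) ^+ 2.
  have [e eb] : exists e : nat, 6 * bform x x < e%:R.
    exists (Num.bound (6 * bform x x)); apply: archi_boundP.
    exact: le_trans (sqr_ge0 _) (coef_bound ord0 x).
  exists e; apply: lt_trans eb _; rewrite -natrX -natrX ltr_nat.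
  apply: leq_trans (ltn_expl e (ltnSn 1)) _.
  by rewrite expnS expn1 leq_pmulr // expn_gt0.
exists (e.*2 + 2)%N => t et; pose m := trunc_log 2 t.
have t0 : (0 < t)%N by apply: leq_trans et; rewrite expn_gt0.
have /andP[mt tm] := trunc_log_bounds (ltnSn 1) t0.
have em : (e.*2 + 2 <= m)%N by exact: trunc_log_max.
have Nm : (e.*2 + 2 <= 2 ^ m)%N by exact: leq_trans em (ltnW (ltn_expl m (ltnSn 1))).
have tm' : (t < 2 ^ m + 2 ^ m)%N by move: tm; rewrite expnS mul2n addnn.
rewrite cE (dyadic_vanish (rec m) Nm _ mt tm') //= => r _ _.
rewrite -(ltr_int R) intr_norm -cE rmorphXn /=.
rewrite -(@ltr_pXn2r _ 2%N) ?nnegrE ?exprn_ge0 // real_normK ?num_real //.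
apply: le_lt_trans eb; rewrite -(bform_lin_unplace r x); exact: coef_bound.
Qed.

(** If moreover every horizontal direction recurs, the vector is orthogonal to
    all of them. *)
Lemma translation_trivial x : x ord0 ord0 = 0 ->
  (forall k, integral (lin_unplace k x)) ->
  (forall m t, (2 ^ m <= t)%N -> (t + 2 < 2 ^ m + 2 ^ m)%N ->
     ix t.+2 = ix t /\ ix t.+1 != ix t) ->
  (forall i m, i != ord0 -> exists2 t, (2 ^ m <= t)%N & ix t = i) -> x = 0.
Proof.
move=> x0 xint blk rcr; have [m0 cm] := block_coef0 xint blk.
pose z := lin_unplace (2 ^ m0) x.
have zE k : lin_unplace (2 ^ m0 + k) x = z.
  elim: k => [|k IHk]; first by rewrite addn0.
  by rewrite addnS /= /lin_refl cm ?leq_addr // scale0r subr0.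
have z0 : z = 0.
  apply: coef_eq0 => [|i i0]; first by rewrite lin_unplace_ord0.
  have [t mt <-] := rcr i m0 i0.
  by rewrite -(zE (t - 2 ^ m0)%N) subnKC // cm.
by rewrite -(lin_unplaceK (2 ^ m0) x) -/z z0 mul0mx.
Qed.

End LatticeSequence.

(** * The order of the reflections *)

(** On the block [2 ^ m <= k < 2 ^ m.+1] the reflections of the [m]-th and
    [m.+1]-st horizontal directions, counted cyclically, alternate. *)
Definition refl_order (k : nat) : 'I_n.+1 :=
  inord (((trunc_log 2 k + odd k) %% n).+1).

Lemma val_refl_order k : (0 < n)%N ->
  refl_order k = ((trunc_log 2 k + odd k) %% n).+1 :> nat.
Proof. by move=> n0; rewrite inordK // ltnS ltn_mod. Qed.

Lemma refl_order_neq0 k : (0 < n)%N -> refl_order k != ord0.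
Proof. by move=> n0; rewrite -val_eqE /= val_refl_order. Qed.

Lemma refl_order_block m t : (1 < n)%N -> (2 ^ m <= t)%N ->
  (t + 2 < 2 ^ m + 2 ^ m)%N ->
  refl_order t.+2 = refl_order t /\ refl_order t.+1 != refl_order t.
Proof.
move=> n1 mt tm.
have lg k : (k <= 2)%N -> trunc_log 2 (k + t) = m.
  by move=> k2; apply: trunc_log_eq => //; rewrite expnS; lia.
have lg0 : trunc_log 2 t = m by exact: (lg 0).
have lg1 : trunc_log 2 t.+1 = m by exact: (lg 1).
have lg2 : trunc_log 2 t.+2 = m by exact: (lg 2).
split; first by rewrite /refl_order lg2 lg0 /= negbK.
rewrite -val_eqE /= !val_refl_order ?(ltnW n1) // lg1 lg0 eqSS /=.
have md : (m + 1 != m %[mod n])%N.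
  by rewrite -[X in _ != X %[mod _]]addn0 eqn_modDl mod0n modn_small.
by case: (odd t); rewrite /= !addn0 // eq_sym.
Qed.

Lemma refl_order_recurs i m : (0 < n)%N -> i != ord0 ->
  exists2 t, (2 ^ m <= t)%N & refl_order t = i.
Proof.
move=> n0 i0; pose r := (val i).-1.
have ri : i = r.+1 :> nat by rewrite /r prednK // lt0n.
have rn : (r < n)%N by rewrite -ltnS -ri.
exists (2 ^ (r + n * m.+1))%N.
  rewrite leq_exp2l // (leq_trans (leqnSn m)) //.
  by rewrite (leq_trans _ (leq_addl _ _)) // leq_pmull.
apply: val_inj; rewrite /= val_refl_order // ri; congr S.
rewrite trunc_expnK // oddX orbF addn_eq0 muln_eq0 andbC.
by rewrite (gtn_eqF n0) /= addn0 addnC mulnC modnMDl modn_small.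
Qed.

End Lattices.

(** * The stack of layers as a tiling *)

Section StackTiling.
Variables (R : realType) (n : nat).
Local Notation E := 'rV[R]_n.+1.
Implicit Types (x y s t : E) (m u w : 'rV[int]_n.+1) (i j : 'I_n.+1).

Variable B : 'M[R]_n.+1.
Hypothesis Bu : B \in unitmx.
Hypothesis BE : forall x y, dotp (x *m B) (y *m B) = bform x y.
Variable ix : nat -> 'I_n.+1.
Hypothesis ix0 : forall k, ix k != ord0.

Local Notation L := (mulmxr B).
Local Notation coords x := (x *m invmx B).

(** The linear part of [frame]. *)
Definition frame_mx k : 'M[R]_n.+1 := place_mx R ix k *m B.

(** The passage from lattice coordinates in the layer with number [k] to
    Euclidean coordinates. *)
Definition frame k : E -> E := affine_map (frame_mx k) (place ix k 0 *m B).

(** The tile of index [m], in the layer between the heights [m ord0 ord0] and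
    [m ord0 ord0 + 1]. *)
Definition tile m : set E := frame `|m ord0 ord0|%N @` cube R m.

(** The stack of layers. *)
Definition stack : set (set E) := [set tile m | m in setT].

Lemma frameE k s : frame k s = place ix k s *m B.
Proof. by rewrite placeE /frame /affine_map mulmxDl mulmxA. Qed.

Lemma frame_mx_unit k : frame_mx k \in unitmx.
Proof.
rewrite unitmx_mul Bu andbT; elim: k => [|k IHk] /=; first exact: unitmx1.
rewrite unitmx_mul IHk andbT.
suff /mulmx1_unit[] : refl_mx R (ix k) *m refl_mx R (ix k) = 1%:M by [].
apply/row_matrixP => i.
by rewrite !rowE mulmx1 mulmxA !mul_refl_mx lin_reflK.
Qed.

Lemma frame_inj k : injective (frame k).
Proof. exact/can_inj/affine_mapK/frame_mx_unit. Qed.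

Lemma frame_ord0 k s : coords (frame k s) ord0 ord0 = s ord0 ord0.
Proof. by rewrite frameE mulmxK // place_ord0. Qed.

Lemma tileP m x : tile m x -> exists2 s, cube R m s & x = frame `|m ord0 ord0| s.
Proof. by move=> [s sm <-]; exists s. Qed.

Lemma tile_height m x : tile m x ->
  (m ord0 ord0)%:~R <= coords x ord0 ord0 <= (m ord0 ord0)%:~R + 1.
Proof. by move=> /tileP[s sm ->]; rewrite frame_ord0; exact: sm. Qed.

Lemma stack_countable : countable stack.
Proof. exact: sub_countable (card_image_le _ _) (countableP _). Qed.

Lemma stack_cover : \bigcup_(T in stack) T = setT.
Proof.
apply/seteqP; split=> // x _.
pose k := Num.floor (coords x ord0 ord0); pose s := unplace ix `|k| (coords x).
pose m : 'rV[int]_n.+1 := \row_i Num.floor (s ord0 i).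
have mk : m ord0 ord0 = k by rewrite mxE unplace_ord0.
exists (tile m); first by exists m.
exists s; last by rewrite mk frameE unplaceK // mulmxKV.
move=> i; rewrite mxE.
by have /andP[-> /ltW] := floor_itv (s ord0 i); rewrite intrD.
Qed.

Lemma stack_disjoint T1 T2 : stack T1 -> stack T2 -> T1 <> T2 ->
  interior T1 `&` interior T2 = set0.
Proof.
move=> [m _ <-] [m' _ <-] mm'; apply/seteqP; split=> // x [].
move=> /(affine_cube_interior (frame_mx_unit _))[s xs sm].
move=> /(affine_cube_interior (frame_mx_unit _))[s' xs' sm'].
have intv (a b : int) (r : R) : a%:~R < r < a%:~R + 1 ->
    b%:~R < r < b%:~R + 1 -> a = b.
  move=> /andP[ar ra] /andP[br rb].
  have : a%:~R < (b + 1)%:~R :> R by rewrite intrD; lra.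
  have : b%:~R < (a + 1)%:~R :> R by rewrite intrD; lra.
  by rewrite !ltr_int; lia.
have ss0 : s ord0 ord0 = s' ord0 ord0.
  by rewrite -(frame_ord0 `|m ord0 ord0|) -[frame _ s]xs xs' frame_ord0.
have h : m ord0 ord0 = m' ord0 ord0.
  by apply: intv (sm ord0) _; rewrite ss0; exact: sm'.
have ss : s = s'.
  by apply: (@frame_inj `|m ord0 ord0|); rewrite -[LHS]xs xs' h.
apply: mm'; congr tile; apply: row_ext => i.
by apply: intv (sm i) _; rewrite ss; exact: sm'.
Qed.

Lemma stack_tiling : tiling_by_convex_polytopes stack.
Proof.
split.
  split; [exact: stack_countable| |exact: stack_cover|exact: stack_disjoint].
  by move=> _ [m _ <-]; exact: affine_cube_compact.
move=> _ [m _ <-]; split; first exact: affine_cube_polytope.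
exact: affine_cube_interior_neq0 (frame_mx_unit _) m.
Qed.

(** A vertex of the second layer lies at a quarter of an edge of the first. *)
Lemma stack_not_face_to_face : ~ face_to_face stack.
Proof.
move=> ftf.
pose e0 : 'rV[int]_n.+1 := delta_mx ord0 ord0.
pose i := ix 0; pose a : E := delta_mx ord0 ord0.
pose b : E := a + delta_mx ord0 i.
have i0 : (i == ord0) = false by exact/negbTE/ix0.
have h0 : hsum a = 0.
  by apply: big1 => j /negbTE j0; rewrite mxE j0 andbF.
have ca : coef i a = 0 by rewrite /coef h0 mxE i0 /=; ring.
have [F1 _] := ftf (tile 0) (tile e0) (ex_intro2 _ _ 0 I erefl)
  (ex_intro2 _ _ e0 I erefl).
have T0 s : cube R 0 s -> tile 0 (s *m B).
  by exists s => //; rewrite frameE mxE.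
have Ta : tile 0 (a *m B).
  by apply: T0 => j; rewrite !mxE /=; case: (j == _); rewrite /=;
    apply/andP; split; lra.
have Tb : tile 0 (b *m B).
  apply: T0 => j; rewrite !mxE /=; have [->|j0] := eqVneq j ord0.
    by rewrite eq_sym i0 /=; apply/andP; split; lra.
  by case: (j == i); rewrite /=; apply/andP; split; lra.
have mE : (3 / 4) *: (a *m B) + (1 - 3 / 4) *: (b *m B) = refl i a *m B.
  rewrite !scalemxAl -mulmxDl; congr (_ *m B).
  rewrite /refl ca sub0r scaleNr opprK /b scalerDr addrA -scalerDl.
  by congr (_ + _ *: _); [rewrite -[RHS]scale1r; congr (_ *: _)|]; field.
have Tm : tile e0 (refl i a *m B).
  rewrite /tile !mxE /=; exists a; last by rewrite frameE.
  by move=> j; rewrite !mxE /=; case: (j == ord0); rewrite /=;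
    apply/andP; split; lra.
have /convex_setP cT : @convex_set R E (tile 0) by exact: affine_cube_convex.
have [|||_ [_ /tileP[s se]]] := face_segment (l := 3 / 4) F1 Ta Tb.
- by lra.
- by lra.
- by rewrite mE; split=> //; rewrite -mE; apply: cT => //; lra.
rewrite frameE !mxE /= => /(can_inj (mulmxK Bu)) bs.
have sE : s = refl i b by rewrite bs reflK ?ix0.
have := se i; rewrite sE /refl coefD ca coef_delta ?ix0 // eqxx !mxE !eqxx i0 /=.
by move=> /andP[? ?]; lra.
Qed.

(** * Translations *)

Lemma cube_shift m w :
  cube R (m + w) = [set s + ivec R w | s in cube R m].
Proof.
apply/seteqP; split=> [s sm|_ [s sm <-] i].
  exists (s - ivec R w); last by rewrite subrK.
  move=> i; have := sm i; rewrite !mxE intrD => /andP[? ?].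
  by apply/andP; split; lra.
by have := sm i; rewrite !mxE intrD => /andP[? ?]; apply/andP; split; lra.
Qed.

Lemma tile_shift m w : w ord0 ord0 = 0 -> tile (m + w) =
  [set x + ivec R w *m frame_mx `|m ord0 ord0|%N | x in tile m].
Proof.
move=> w0; rewrite /tile mxE w0 addr0 cube_shift.
set k := absz _; transitivity ((frame k \o (fun s => s + ivec R w)) @` cube R m).
  by rewrite -image_comp.
transitivity (((fun x => x + ivec R w *m frame_mx k) \o frame k) @` cube R m).
  by apply: eq_imagel => s _; rewrite /= /frame /affine_map mulmxDl addrA.
by rewrite -image_comp.
Qed.

Lemma translation_height t m m' :
  [set x + t | x in tile m] = tile m' ->
  (m ord0 ord0)%:~R + coords t ord0 ord0 = (m' ord0 ord0)%:~R.
Proof.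
move=> tm.
have h (b : int) : 0 <= b <= 1 ->
  (m' ord0 ord0)%:~R <= (m ord0 ord0 + b)%:~R + coords t ord0 ord0
    <= (m' ord0 ord0)%:~R + 1.
  move=> b01; pose s : E := ivec R m + b%:~R *: delta_mx ord0 ord0.
  have sm : cube R m s.
    move=> i; rewrite /s !mxE.
    have : 0 <= (b%:~R : R) <= 1 by rewrite ler0z lerz1.
    by case: (i == ord0); rewrite /= => /andP[? ?]; apply/andP; split; lra.
  have : tile m' (frame `|m ord0 ord0|%N s + t).
    by rewrite -tm; exists (frame `|m ord0 ord0|%N s) => //; exists s.
  move=> /tile_height; rewrite mulmxDl mxE frame_ord0 /s !mxE !eqxx /= mulr1.
  by rewrite intrD.
have /andP[h0 _] := h 0 isT; have /andP[_ h1] := h 1 isT.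
by move: h0 h1; rewrite !intrD; lra.
Qed.

Lemma image_shift_add (K : set E) (a b : E) :
  [set x + b | x in [set x + a | x in K]] = [set x + (a + b) | x in K].
Proof.
transitivity (((fun x => x + b) \o (fun x => x + a)) @` K).
  by rewrite -image_comp.
by apply: eq_imagel => x _; rewrite /= addrA.
Qed.

(** A translation of the stack carries the lattice of every layer into the
    lattice of the image layer. *)
Lemma translation_lattice t m m' :
  (forall m1, exists m2, [set x + t | x in tile m1] = tile m2) ->
  [set x + t | x in tile m] = tile m' ->
  forall x, x ord0 ord0 = 0 -> integral (lin_unplace ix `|m ord0 ord0| x) ->
    integral (lin_unplace ix `|m' ord0 ord0| x).
Proof.
move=> tau_t tm x x0 [w xw].
have w0 : w ord0 ord0 = 0.
  by apply: (@intr_inj R); rewrite -ivecE -xw lin_unplace_ord0.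
have [m2 m2E] := tau_t (m + w).
have h2 : m2 ord0 ord0 = m' ord0 ord0.
  apply: (@intr_inj R); rewrite -(translation_height m2E).
  by rewrite -(translation_height tm) mxE w0 addr0.
pose v := m2 - m'.
have v0 : v ord0 ord0 = 0 by rewrite !mxE h2 subrr.
have m2v : m2 = m' + v by rewrite /v addrC subrK.
move: m2E; rewrite m2v !tile_shift // image_shift_add addrC -image_shift_add tm.
move=> /(affine_cube_shift_inj (frame_mx_unit _)).
rewrite /frame_mx !mulmxA => /(can_inj (mulmxK Bu)).
rewrite -xw lin_unplaceK // => ->; exists v; exact: lin_unplace_mulK.
Qed.

Lemma stack_non_periodic : (0 < n)%N ->
  (forall x, x ord0 ord0 = 0 -> (forall k, integral (lin_unplace ix k x)) ->
     x = 0) ->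
  non_periodic stack.
Proof.
move=> n0 triv t [_ tE].
have tau_t m1 : exists m2, [set x + t | x in tile m1] = tile m2.
  have : stack [set x + t | x in tile m1].
    by rewrite -tE; exists (tile m1) => //; exists m1.
  by case=> m2 _ <-; exists m2.
have [m0 m0E] := tau_t 0; pose q := m0 ord0 ord0.
have tq : coords t ord0 ord0 = q%:~R.
  have <- := translation_height m0E.
  by rewrite (_ : (0 : 'rV[int]_n.+1) ord0 ord0 = 0) ?add0r // mxE.
pose lev (a : int) : 'rV[int]_n.+1 := a *: delta_mx ord0 ord0.
have lev0 a : lev a ord0 ord0 = a by rewrite !mxE mulr1.
have stp (a : int) x : x ord0 ord0 = 0 ->
    integral (lin_unplace ix `|a| x) -> integral (lin_unplace ix `|a + q| x).
  move=> x0 xa; have [m mE] := tau_t (lev a).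
  have <- : m ord0 ord0 = a + q.
    apply: (@intr_inj R); rewrite -(translation_height mE) tq lev0.
    by rewrite -intrD.
  by apply: (translation_lattice tau_t mE) => //; rewrite lev0.
have [q0|qn0] := eqVneq q 0.
  have t0 : coords t = 0.
    apply: triv; first by rewrite tq q0.
    move=> k; have [m mE] := tau_t (lev k).
    have mk : m ord0 ord0 = k.
      apply: (@intr_inj R); rewrite -(translation_height mE) tq q0 lev0.
      by rewrite addr0.
    pose v := m - lev k.
    have v0 : v ord0 ord0 = 0 by rewrite /v mxE [X in _ + X]mxE lev0 mk subrr.
    have mv : m = lev k + v by rewrite /v addrC subrK.
    move: mE; rewrite mv tile_shift // => /(affine_cube_shift_inj (frame_mx_unit _)).
    rewrite /frame_mx lev0 mulmxA absz_nat => ->; rewrite mulmxK //.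
    by exists v; exact: lin_unplace_mulK.
  by rewrite -(mulmxKV Bu t) t0 mul0mx.
have [x [x0 xn0 xq]] := common_translation R ix `|q| n0.
case/eqP: xn0; apply: triv => // k.
elim/ltn_ind: k => k IHk; have [|qk] := leqP k `|q|; first exact: xq.
(* layers of opposite numbers are equally placed, so both signs of q shift
   the sequence of lattices by |q| *)
have [q1|q1] := leP 0 q.
  have := stp (k%:Z - q) x x0; rewrite subrK absz_nat; apply.
  by apply: IHk; lia.
have := stp (- (k%:Z + q)) x x0.
rewrite (_ : `|(- (k%:Z + q) + q)%R|%N = k); last by lia.
by apply; apply: IHk; lia.
Qed.

(** * Vertex coronae *)

Lemma stack_vertexP x : tiling_vertex stack x ->
  exists (l : int) u, x = frame `|l| (ivec R u) /\
    (l = u ord0 ord0 - 1 \/ l = u ord0 ord0).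
Proof.
move=> [_ [m _ <-] /affine_cube_vertex -/(_ (@frame_inj _))[b ->]].
exists (m ord0 ord0), (corner m b); split=> //.
by rewrite !mxE; case: (b ord0) => /=; [left|right]; lia.
Qed.

Lemma stack_layer_tiles (k : int) :
  image_tiles L (stack_layer ix k) =
  [set tile m | m in [set m : 'rV[int]_n.+1 | m ord0 ord0 = k]].
Proof.
rewrite /stack_layer -image_tiles_comp; apply/seteqP; split.
  move=> _ [_ [m /= mk <-] <-]; exists m => //.
  by rewrite /tile mk; apply: eq_imagel => s _; rewrite frameE.
move=> _ [m /= mk <-]; exists (cube R m); first by exists m.
by rewrite /tile mk; apply: eq_imagel => s _; rewrite /= -frameE.
Qed.

Lemma corona_image (f : E -> E) tau x : injective f ->
  image_tiles f (vertex_corona tau x).2 =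
  (vertex_corona (image_tiles f tau) (f x)).2.
Proof.
move=> finj; apply/seteqP; split=> [_ [T [tauT Tx] <-]|_ [[T tauT <-]]].
  by split; [exists T|exists x].
by move=> [y Ty /finj <-]; exists T.
Qed.

Lemma stack_corona (k : int) x : coords x ord0 ord0 = k%:~R ->
  (vertex_corona (image_tiles L (stack_layer ix (k - 1) `|`
    stack_layer ix k)) x).2 = (vertex_corona stack x).2.
Proof.
move=> xk; rewrite /= image_tilesU !stack_layer_tiles; apply/seteqP; split.
  by move=> T [[[m _ <-]|[m _ <-]] Tx]; split=> //; exists m.
move=> _ [[m _ <-] Tx]; split=> //.
have := tile_height Tx; rewrite xk -intrD1 !ler_int => mk.
have [mk'|mk'] : m ord0 ord0 = k - 1 \/ m ord0 ord0 = k by lia.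
  by left; exists m.
by right; exists m.
Qed.

Lemma isometry_conj (F : E -> E) : bform_isometry F ->
  exists Q t, orthogonal_group Q /\ affine_map Q t \o L = L \o F.
Proof.
move=> [M [t [hM ->]]]; exists (invmx B *m M *m B), (t *m B).
split; first exact: bform_preserving_conj.
by apply/funext => x; rewrite /affine_map /= mulmxDl !mulmxA mulmxK.
Qed.

(** The corona to which all vertex coronae are congruent. *)
Definition standard_corona i0 : set (set E) :=
  (vertex_corona (image_tiles L (interface i0)) 0).2.

Lemma corona_standard i0 x : i0 != ord0 -> tiling_vertex stack x ->
  exists Q t, [/\ orthogonal_group Q, affine_map Q t 0 = x &
    image_tiles (affine_map Q t) (standard_corona i0) =
      (vertex_corona stack x).2].
Proof.
move=> i00 /stack_vertexP[l [u [xE lu]]].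
have [F [Fi F0 FI]] := stack_vertex R ix0 i00 lu.
have [Q [t [Qo QF]]] := isometry_conj Fi.
have Q0 : affine_map Q t 0 = x.
  transitivity ((affine_map Q t \o L) 0); first by rewrite /= mul0mx.
  by rewrite QF /= F0 -frameE -xE.
have Qinj : injective (affine_map Q t).
  by apply/can_inj/affine_mapK; have /mulmx1_unit[] := Qo.
exists Q, t; split=> //.
rewrite corona_image // Q0 -image_tiles_comp QF image_tiles_comp FI.
by apply: stack_corona; rewrite xE frame_ord0 ivecE.
Qed.

Lemma standard_corona_swap i0 a b : i0 != ord0 -> a != ord0 -> b != ord0 ->
  a != i0 -> b != i0 -> a != b ->
  exists Q, [/\ orthogonal_group Q, \det Q = -1 &
    image_tiles (affine_map Q 0) (standard_corona i0) = standard_corona i0].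
Proof.
move=> i00 a0 b0 ai bi ab; pose p := tperm a b.
have p0 : p ord0 = ord0 by rewrite tpermD.
pose M := signed_perm_mx R false false p; pose Q := invmx B *m M *m B.
have Qo : orthogonal_group Q.
  by apply: bform_preserving_conj => //; exact: signed_perm_preserving.
have QL : affine_map Q 0 \o L = L \o signed_perm false false p 0.
  apply/funext => x; rewrite signed_permE /affine_map /= add0r !mulmxA mulmxK //.
  by rewrite mulmxDl (_ : ivec R 0 = 0) ?mul0mx ?add0r // /ivec map_mx0.
have Qinj : injective (affine_map Q 0).
  by apply/can_inj/affine_mapK; have /mulmx1_unit[] := Qo.
exists Q; split=> //.
  have -> : \det Q = \det M.
    rewrite !det_mulmx mulrAC -det_mulmx mulVmx // det1 mul1r //.
  have -> : M = perm_mx p.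
    apply/matrixP => c e; rewrite !mxE /sg if_same expr0 mul1r.
    by rewrite /p -[in LHS](tpermK a b c) (inj_eq perm_inj).
  by rewrite det_perm odd_tperm ab.
rewrite corona_image // -image_tiles_comp QL image_tiles_comp interface_swap //.
by rewrite /affine_map mul0mx addr0.
Qed.

End StackTiling.

(** * Congruent coronae, directly or not *)

(** A tiling is monocoronal when all its coronae are images of one and the same
    set of tiles under the isometries in question. *)
Lemma monocoronal_standard (R : realType) (d : nat) (G : set 'M[R]_d)
    (tau S : set (set 'rV[R]_d)) :
  (forall Q, G Q -> orthogonal_group Q) ->
  (forall P Q, G P -> G Q -> G (P^T *m Q)) ->
  (forall x, tiling_vertex tau x -> exists Q t,
     [/\ G Q, affine_map Q t 0 = x &
         image_tiles (affine_map Q t) S = (vertex_corona tau x).2]) ->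
  monocoronal G tau.
Proof.
move=> Go Gc h x y /h[P [t [GP Px PS]]] /h[Q [u [GQ Qy QS]]].
have PQ : affine_map (P^T *m Q) (u - t *m (P^T *m Q)) \o affine_map P t
    = affine_map Q u.
  by rewrite affine_map_comp subrK mulmxA (Go _ GP) mul1mx.
exists (P^T *m Q), (u - t *m (P^T *m Q)); split; first exact: Gc.
  by rewrite -[y in RHS]Qy -PQ /= Px.
by rewrite -PS -image_tiles_comp PQ.
Qed.

(** The properties of the stack that both parts of the theorem use; [S] is the
    common shape of the vertex coronae. *)
Lemma stack_exists (R : realType) (n : nat) (i0 : 'I_n.+1) : (1 < n)%N ->
  i0 != ord0 -> exists tau S : set (set 'rV[R]_n.+1),
  [/\ tiling_by_convex_polytopes tau, ~ face_to_face tau, non_periodic tau,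
      forall x, tiling_vertex tau x -> exists Q t,
        [/\ orthogonal_group Q, affine_map Q t 0 = x &
         image_tiles (affine_map Q t) S = (vertex_corona tau x).2] &
      forall a b : 'I_n.+1, a != ord0 -> b != ord0 -> a != i0 -> b != i0 -> a != b ->
        exists Q, [/\ orthogonal_group Q, \det Q = -1 &
          image_tiles (affine_map Q 0) S = S]].
Proof.
move=> n1 i00; have n0 := ltnW n1.
have [B Bu BE] := basis_exists R n.
have ix0 k := @refl_order_neq0 n k n0.
exists (stack B (refl_order n)), (standard_corona B i0); split.
- exact: stack_tiling.
- exact: stack_not_face_to_face.
- apply: stack_non_periodic => // x x0 xint.
  apply: translation_trivial xint _ _ => //.
    by move=> m t; exact: refl_order_block.
  by move=> i m; exact: refl_order_recurs.
- by move=> x; exact: corona_standard.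
- by move=> a b *; apply: (standard_corona_swap Bu BE (a := a) (b := b)).
Qed.

Lemma orthogonal_det (R : realType) (d : nat) (Q : 'M[R]_d) :
  orthogonal_group Q -> \det Q = 1 \/ \det Q = -1.
Proof.
move=> /(congr1 determinant); rewrite det_mulmx det_tr det1 -expr2 => /eqP.
by rewrite sqrf_eq1 => /orP[]/eqP; [left|right].
Qed.

Lemma orthogonal_trmul (R : realType) (d : nat) (P Q : 'M[R]_d) :
  orthogonal_group P -> orthogonal_group Q -> orthogonal_group (P^T *m Q).
Proof.
rewrite /orthogonal_group /= => PP QQ.
by rewrite trmx_mul trmxK mulmxA -(mulmxA P^T) QQ mulmx1 (mulmx1C PP).
Qed.

Theorem theorem3p2 (R : realType) :
  (forall d : nat, (3 <= d)%N ->
     exists tau : set (set 'rV[R]_d),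
       [/\ tiling_by_convex_polytopes tau, ~ face_to_face tau,
           non_periodic tau & monocoronal_up_to_congruence tau]) /\
  (forall d : nat, (4 <= d)%N ->
     exists tau : set (set 'rV[R]_d),
       [/\ tiling_by_convex_polytopes tau, ~ face_to_face tau,
           non_periodic tau & monocoronal_up_to_rigid_motions tau]).
Proof.
split=> [[|n] // n3|[|n] // n4].
  have i00 : (inord 1 : 'I_n.+1) != ord0 by rewrite -val_eqE /= inordK; lia.
  have [tau [S [tt nf np cor _]]] := stack_exists R (ltac:(lia) : (1 < n)%N) i00.
  exists tau; split=> //; apply: monocoronal_standard cor => //.
  exact: orthogonal_trmul.
pose i k : 'I_n.+1 := inord k.
have iE k : (k < 4)%N -> i k = k :> nat by move=> k4; rewrite inordK //; lia.
have neq a b : (a < 4)%N -> (b < 4)%N -> a != b -> i a != i b.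
  by move=> a4 b4; rewrite -val_eqE /= !iE.
have i0E : ord0 = i 0 by apply: val_inj; rewrite /= iE.
have i1 : i 1 != ord0 by rewrite i0E neq.
have [tau [S [tt nf np cor swp]]] := stack_exists R (ltac:(lia) : (1 < n)%N) i1.
have [W [Wo Wd WS]] : exists Q : 'M[R]_n.+1, [/\ orthogonal_group Q,
    \det Q = -1 & image_tiles (affine_map Q 0) S = S].
  by apply: (swp (i 2) (i 3)); rewrite ?i0E neq.
exists tau; split=> //; apply: (@monocoronal_standard _ _ _ _ S).
- by move=> Q [].
- move=> P Q [Po Pd] [Qo Qd]; split; first exact: orthogonal_trmul.
  by rewrite det_mulmx det_tr Pd Qd mulr1.
move=> x /cor[Q [t [Qo Qx QS]]]; have [Qd|Qd] := orthogonal_det Qo.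
  by exists Q, t.
(* a corona map that reverses orientation is corrected by the swap *)
exists (W *m Q), t; split.
- split; last by rewrite det_mulmx Wd Qd mulrNN mulr1.
  rewrite /orthogonal_group /= trmx_mul mulmxA -(mulmxA W) Qo mulmx1; exact: Wo.
- by rewrite -Qx /affine_map !mul0mx.
have -> : affine_map (W *m Q) t = affine_map Q t \o affine_map W 0.
  by rewrite affine_map_comp mul0mx addr0.
by rewrite image_tiles_comp WS.
Qed.
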